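(* Let $f:\mathbb{R}^n\times[0,\infty)\to\mathbb{R}^n$ be continuous and let $s:[0,\infty)\to\mathbb{R}^n$ be a solution of $\dot s(t)=f(s(t),t)$. Let $A=(a_{ij})\in\mathbb{R}^{m\times m}$ (not necessarily symmetric) be irreducible with $\operatorname{Rank}(A)=m-1$, $a_{ij}\ge 0$ for $i\neq j$ and $\sum_{j=1}^m a_{ij}=0$ for all $i$, and let $\varepsilon>0$. Suppose there are diagonal matrices with positive diagonal entries $P=\operatorname{diag}\{p_1,\dots,p_n\}$, $\Delta=\operatorname{diag}\{\Delta_1,\dots,\Delta_n\}$ and a constant $\eta>0$ such that $$(x-y)^{\top}P\big(f(x,t)-\Delta x-f(y,t)+\Delta y\big)\le-\eta\,(x-y)^{\top}(x-y)\qquad\text{for all }x,y\in\mathbb{R}^n,\ t\ge 0.$$ Let $\alpha>0$ and consider the adaptive controlled network for $(x_1,\dots,x_m,c)$, with $x_i(t)\in\mathbb{R}^n$, $c(t)\in\mathbb{R}$ and $c(0)\ge 0$: $$\dot x_1(t)=f(x_1(t),t)+c(t)\sum_{j=1}^m a_{1j}x_j(t)-c(t)\varepsilon\,(x_1(t)-s(t)),$$ $$\dot x_i(t)=f(x_i(t),t)+c(t)\sum_{j=1}^m a_{ij}x_j(t)\quad(i=2,\dots,m),$$ $$\dot c(t)=\frac{\alpha}{2}\sum_{i=1}^m (x_i(t)-s(t))^{\top}P\,(x_i(t)-s(t)).$$ Then every solution on $[0,\infty)$ synchronizes to the given trajectory $s(t)$, i.e. $\lim_{t\to\infty}\|x_i(t)-s(t)\|=0$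 for all $i=1,\dots,m$. *)

(* Defs.v *)
From HB Require Import structures.
From mathcomp Require Import all_boot all_order all_algebra all_fingroup.
From mathcomp Require Import all_classical all_reals all_analysis.
Set Implicit Arguments.
Unset Strict Implicit.
Unset Printing Implicit Defensive.
Import Order.TTheory GRing.Theory Num.Theory.
Import numFieldNormedType.Exports.
Local Open Scope classical_set_scope.
Local Open Scope ring_scope.

(* Derivative of a function whose domain is [0, +oo): two-sided for t > 0,
   one-sided from the right at t = 0; values of g at negative times are
   irrelevant (for 0 <= t). *)
Definition is_derive_ray (R : realType) (V : normedModType R)
    (g : R -> V) (t : R) (v : V) : Prop :=
  h^-1 *: (g (t + h) - g t) @[h --> within [set h | 0 <= t + h] 0^'] --> v.

(* A is carried by a simultaneous permutation of rows and columns to the block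
   upper triangular form [B C; 0 D] with square diagonal blocks B, of size k,
   and D, both of positive size. *)
Definition reducible_mx (R : realType) (m : nat) (A : 'M[R]_m) : Prop :=
  exists (s : 'S_m) (k : nat), (0 < k < m)%N /\
    forall i j : 'I_m, (k <= i)%N -> (j < k)%N ->
      (perm_mx s *m A *m (perm_mx s)^T) i j = 0.

Definition irreducible_mx (R : realType) (m : nat) (A : 'M[R]_m) : Prop :=
  ~ reducible_mx A.

(* Euclidean norm; the library's norm `|x| on matrices is the max norm. *)
Definition enorm (R : realType) (n : nat) (x : 'cV[R]_n) : R :=
  Num.sqrt ((x^T *m x) 0 0).

(* Main.v *)
(* With [e_i = x_i - s], the left kernel of [A] contains a positive vector [xi],
   and [U = 1/2 \sum_i xi_i e_i^T P e_i] satisfies [U' <= (K - lam c) W], where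
   [W = \sum_i e_i^T P e_i], [lam > 0] comes from the negative definiteness of
   the symmetrized pinned coupling [diag xi (A - eps E_11)], and
   [c' = alpha / 2 W].  So with [a = alpha / 2] the quantity
   [U + (lam c^2 / 2 - K c) / a] is nonincreasing, which bounds [c]; and
   [U - (K / a) c] is nonincreasing, so beyond a time at which [c] is close to
   its supremum [U] can hardly increase.  As [c' >= a b U] for some [b > 0] and
   [c] is bounded, [U] also becomes arbitrarily small at arbitrarily late times;
   hence [U -> 0]. *)
Require Import Defs.
From HB Require Import structures.
From mathcomp Require Import all_boot all_order all_algebra all_fingroup.
From mathcomp Require Import all_classical all_reals all_analysis.
From mathcomp Require Import ring lra.
Set Implicit Arguments.
Unset Strict Implicit.
Unset Printing Implicit Defensive.
Import Order.TTheory GRing.Theory Num.Theory.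
Import numFieldNormedType.Exports.
Local Open Scope classical_set_scope.
Local Open Scope ring_scope.

(** * Irreducible matrices with zero row sums: a positive left null vector *)

(** Listing the complement of [S] first and [S] last permutes [A] into block upper triangular form,
    the entries from [S] to its complement filling the lower left block. So a nonempty proper [S]
    without outgoing edges would make [A] reducible. *)
Lemma irreducible_mx_closed (R : realType) (m : nat) (A : 'M[R]_m)
    (S : {set 'I_m}) (i0 : 'I_m) :
  irreducible_mx A -> i0 \in S ->
  (forall i j, i \in S -> j \notin S -> A i j = 0) -> forall i, i \in S.
Proof.
move=> Airr i0S SA i1; apply/negPn/negP => i1S; apply: Airr.
set l := enum (~: S) ++ enum S.
have lu : uniq l.
  rewrite cat_uniq !enum_uniq andbT /=; apply/hasPn => i /=.
  by rewrite !mem_enum inE negbK.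
have ls : size l = m.
  by rewrite size_cat -!cardE addnC cardsC card_ord.
pose g (i : 'I_m) := nth i0 l i.
have g_inj : injective g.
  move=> i j /eqP; rewrite nth_uniq ?ls ?ltn_ord // => /eqP; exact: val_inj.
exists (perm g_inj), #|~: S|; split.
  apply/andP; split; first by apply/card_gt0P; exists i1; rewrite inE.
  rewrite -[X in (_ < X)%N]card_ord -(cardsC S) -[X in (X < _)%N]add0n ltn_add2r.
  by apply/card_gt0P; exists i0.
move=> i j ki jk; rewrite tr_perm_mx -row_permE -col_permE !mxE !permE.
apply: SA.
  rewrite /g nth_cat -cardE ltnNge ki /= -mem_enum mem_nth // -cardE.
  by rewrite ltn_subLR // addnC cardsC card_ord.
rewrite /g nth_cat -cardE jk; have : nth i0 (enum (~: S)) j \in ~: S.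
  by rewrite -mem_enum mem_nth // -cardE.
by rewrite inE.
Qed.

(** A Perron-Frobenius argument: the absolute value of a nonzero left null vector is again a left
    null vector, and irreducibility spreads its support over all indices. *)
Lemma irreducible_mx_left_kernel_gt0 (R : realType) (m : nat)
    (A : 'M[R]_m.+1) :
  irreducible_mx A -> (forall i j, i != j -> 0 <= A i j) ->
  (forall i, \sum_j A i j = 0) ->
  exists2 xi : 'I_m.+1 -> R,
    forall i, 0 < xi i & forall j, \sum_i xi i * A i j = 0.
Proof.
move=> Airr A_ge0 A_sum.
have /det0P[v v0 vA] : \det A == 0.
  rewrite -det_tr; apply/det0P; exists (const_mx 1).
    by apply/eqP => /rowP /(_ ord0); rewrite !mxE; apply/eqP/oner_neq0.
  apply/rowP => i; rewrite !mxE -[RHS](A_sum i); apply: eq_bigr => j _.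
  by rewrite !mxE mul1r.
have vA0 j : \sum_i v 0 i * A i j = 0.
  by have /rowP/(_ j) := vA; rewrite !mxE.
(* [v *m A = 0] and the signs of the off-diagonal entries give
   [|v| *m A >= 0]; the entries of [|v| *m A] add up to [0], so all vanish. *)
have absv_ge0 j : 0 <= \sum_i `|v 0 i| * A i j.
  have := vA0 j; rewrite (bigD1 j) //= addrC => /eqP; rewrite addr_eq0 => /eqP vj.
  rewrite (bigD1 j) //= -lerBlDl sub0r.
  have: - (`|v 0 j| * A j j) <= `|v 0 j * A j j|.
    by rewrite normrM -mulrN ler_wpM2l // -normrN ler_norm.
  move/le_trans; apply; rewrite -normrN -vj.
  apply: le_trans (ler_norm_sum _ _ _) _; apply: ler_sum => i ij.
  by rewrite normrM (ger0_norm (A_ge0 _ _ ij)).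
have absvA0 j : \sum_i `|v 0 i| * A i j = 0.
  have : \sum_j \sum_i `|v 0 i| * A i j == 0.
    rewrite exchange_big /= big1 // => i _.
    by rewrite -mulr_sumr A_sum mulr0.
  by rewrite psumr_eq0 // => /allP /(_ j); rewrite mem_index_enum => /(_ isT) /eqP.
exists (fun i => `|v 0 i|) => // i; rewrite normr_gt0.
have [i0 vi0] : exists i0, v 0 i0 != 0.
  apply: contrapT => /forallNP nv; move/eqP: v0; apply; apply/rowP => k.
  by rewrite mxE; apply/eqP; rewrite -[_ == _]negbK; apply/negP/nv.
(* The support of [v] is closed under edges: if [v 0 l = 0], column [l] of [|v| *m A] is a vanishing
   sum of nonnegative terms (the diagonal one is zero), so [A k l = 0] whenever [v 0 k != 0]. *)
suff : i \in [set k | v 0 k != 0]%SET by rewrite inE.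
apply: (irreducible_mx_closed Airr (i0 := i0)); first by rewrite inE.
move=> k l; rewrite !inE negbK => vk /eqP vl.
have /eqP := absvA0 l.
rewrite psumr_eq0 => [/allP /(_ k)|j _].
  by rewrite mem_index_enum => /(_ isT) /=; rewrite mulf_eq0 normr_eq0 (negPf vk) => /eqP.
have [->|jl] := eqVneq j l; first by rewrite vl normr0 mul0r.
by rewrite mulr_ge0 // A_ge0.
Qed.

(** * Coercivity of the pinned coupling *)

(** Expand the square: the [y i ^+ 2] terms cancel by the row sums, the [y j ^+ 2] terms by the left
    null vector, and only the cross terms remain. The weights [xi] thus make up for the asymmetry of
    [A]. *)
Lemma balanced_laplacian_form (R : realType) (m : nat) (A : 'M[R]_m.+1)
    (xi y : 'I_m.+1 -> R) :
  (forall i, \sum_j A i j = 0) -> (forall j, \sum_i xi i * A i j = 0) ->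
  \sum_i \sum_j xi i * A i j * (y i - y j) ^+ 2 =
  - 2 * \sum_i xi i * y i * \sum_j A i j * y j.
Proof.
move=> A_sum xiA.
have -> : \sum_i \sum_j xi i * A i j * (y i - y j) ^+ 2 =
    \sum_i (xi i * y i ^+ 2 * \sum_j A i j)
    - 2 * (\sum_i xi i * y i * \sum_j A i j * y j)
    + \sum_i \sum_j xi i * A i j * y j ^+ 2.
  rewrite mulr_sumr -sumrB -big_split /=; apply: eq_bigr => i _.
  rewrite 2!mulr_sumr mulr_sumr -sumrB -big_split /=; apply: eq_bigr => j _; ring.
rewrite big1 => [|i _]; last by rewrite A_sum mulr0.
rewrite exchange_big /= [X in _ + X]big1 => [|j _]; last by rewrite -mulr_suml xiA mul0r.
by rewrite add0r addr0 mulNr.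
Qed.

Lemma pinned_laplacian_coercive (R : realType) (m : nat) (A : 'M[R]_m.+1)
    (eps : R) (xi : 'I_m.+1 -> R) :
  irreducible_mx A -> (forall i j, i != j -> 0 <= A i j) ->
  (forall i, \sum_j A i j = 0) -> 0 < eps ->
  (forall i, 0 < xi i) -> (forall j, \sum_i xi i * A i j = 0) ->
  exists2 lam : R, 0 < lam & forall y : 'I_m.+1 -> R,
    \sum_i xi i * y i * (\sum_j A i j * y j - (i == ord0)%:R * eps * y i)
    <= - lam * \sum_i y i ^+ 2.
Proof.
move=> Airr A_ge0 A_sum eps_gt0 xi_gt0 xiA.
(* [Q] is [-2] times the form to be bounded, written as a sum of nonnegative terms, each of which is
   therefore at most [Q y]. *)
pose Q (y : 'I_m.+1 -> R) := \sum_i \sum_j xi i * A i j * (y i - y j) ^+ 2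
            + 2 * eps * xi ord0 * y ord0 ^+ 2.
have term_ge0 (y : 'I_m.+1 -> R) i j : 0 <= xi i * A i j * (y i - y j) ^+ 2.
  have [->|ij] := eqVneq i j; first by rewrite subrr expr0n mulr0.
  by apply: mulr_ge0 (sqr_ge0 _); apply: mulr_ge0 (ltW (xi_gt0 i)) (A_ge0 _ _ ij).
have dsum_ge0 (y : 'I_m.+1 -> R) :
    0 <= \sum_i \sum_j xi i * A i j * (y i - y j) ^+ 2.
  by apply: sumr_ge0 => i _; apply: sumr_ge0 => j _; exact: term_ge0.
have pin_ge0 (y : 'I_m.+1 -> R) : 0 <= 2 * eps * xi ord0 * y ord0 ^+ 2.
  by rewrite mulr_ge0 ?sqr_ge0 // ltW // !mulr_gt0.
have Q_ge0 y : 0 <= Q y by rewrite addr_ge0.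
have term_leQ y i j : xi i * A i j * (y i - y j) ^+ 2 <= Q y.
  rewrite /Q (bigD1 i) //= (bigD1 j) //= -!addrA lerDl !addr_ge0 //.
    by apply: sumr_ge0 => *; exact: term_ge0.
  by apply: sumr_ge0 => *; apply: sumr_ge0 => *; exact: term_ge0.
(* The nodes at which [y i ^+ 2] is controlled by [Q y] contain the pinned one
   and are closed under the edges of [A]. *)
pose P i := exists C : R, 0 <= C /\ forall y : 'I_m.+1 -> R, y i ^+ 2 <= C * Q y.
have bound i : P i.
  pose S := [set i | `[< P i >]]%SET.
  have SP j : (j \in S) = `[< P j >] by rewrite finset.in_set.
  suff : i \in S by rewrite SP => /asboolP.
  apply: (irreducible_mx_closed Airr (i0 := ord0)) => {i}[|i j].
    rewrite SP; apply/asboolP; exists (2 * eps * xi ord0)^-1.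
    have d_gt0 : 0 < 2 * eps * xi ord0 by rewrite !mulr_gt0.
    split=> [|y]; first by rewrite invr_ge0 ltW.
    by rewrite mulrC ler_pdivlMr // mulrC lerDr.
  rewrite !SP => iS jS; have /asboolP[C [C_ge0 iC]] := iS.
  have ij : i != j by apply: contraNneq jS => <-.
  apply: contrapT => /eqP Aij; move/negP: jS; apply; apply/asboolP.
  have d_gt0 : 0 < xi i * A i j by rewrite mulr_gt0 // lt_neqAle eq_sym Aij A_ge0.
  (* From [y j ^+ 2 <= 2 * y i ^+ 2 + 2 * (y i - y j) ^+ 2], where the difference of the two sides
     is [(2 * y i - y j) ^+ 2]. *)
  exists (2 * C + 2 * (xi i * A i j)^-1); split=> [|y].
    by rewrite addr_ge0 // mulr_ge0 // invr_ge0 ltW.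
  have h1 := iC y.
  have h2 : (y i - y j) ^+ 2 <= (xi i * A i j)^-1 * Q y.
    by rewrite mulrC ler_pdivlMr // mulrC term_leQ.
  have h3 := sqr_ge0 (2 * y i - y j).
  rewrite mulrDl -!mulrA.
  nra.
have [C CP] := choice bound.
(* The summand [1] only keeps [D] positive; the [2] in [(2 * D)^-1] comes from the form being
   [- Q / 2]. *)
pose D := 1 + \sum_i C i.
have D_gt0 : 0 < D by rewrite ltr_wpDr // sumr_ge0 // => i _; case: (CP i).
exists (2 * D)^-1; first by rewrite invr_gt0 mulr_gt0.
move=> y.
have yQ : \sum_i y i ^+ 2 <= D * Q y.
  rewrite /D mulrDl mul1r mulr_suml (le_trans (y := \sum_i C i * Q y)) ?lerDr //.
  by apply: ler_sum => i _; case: (CP i).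
have -> : \sum_i xi i * y i * (\sum_j A i j * y j - (i == ord0)%:R * eps * y i)
    = - (2^-1 * Q y).
  rewrite /Q (balanced_laplacian_form _ A_sum xiA).
  under eq_bigr do rewrite mulrBr.
  rewrite sumrB [X in _ - X](bigD1 ord0) //= [X in _ - (_ + X)]big1 => [|i /negPf ->].
    by rewrite /=; field.
  by rewrite !mul0r mulr0.
rewrite mulNr lerN2 invfM -mulrA ler_pM2l ?invr_gt0 //.
by rewrite mulrC ler_pdivrMr // mulrC.
Qed.

(** * Derivatives on the half-line and monotonicity *)

(* At positive times the one-sided clause of [is_derive_ray] is void. *)
Lemma is_derive_ray_cvg (R : realType) (V : normedModType R) (g : R -> V)
    (t : R) (v : V) :
  0 < t -> is_derive_ray g t v -> h^-1 *: (g (t + h) - g t) @[h --> 0^'] --> v.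
Proof.
move=> t0; rewrite /is_derive_ray => gv; apply: cvg_trans gv; apply: cvg_app.
move=> B; rewrite /within /= => B0.
have th : \forall h \near 0^', 0 <= t + h.
  near=> h; have : `|h| < t by near: h; exact: dnbhs0_lt.
  by rewrite ltr_norml => /andP[th _]; rewrite -lerBlDl sub0r ltW.
by apply: filterS2 th B0 => h h0; exact.
Unshelve. all: by end_near. Qed.

Lemma is_derive_ray_gt0 (R : realType) (g : R -> R) (t v : R) :
  0 < t -> is_derive_ray (g : R -> R^o) t v -> is_derive t (1 : R) g v.
Proof.
move=> t0 /(is_derive_ray_cvg t0) gv.
have {}gv : h^-1 *: ((g \o shift t) (h *: (1 : R)) - g t) @[h --> 0^'] --> v.
  apply: cvg_trans gv; apply: near_eq_cvg; near=> h.
  by rewrite /= [h *: _]mulr1 [h + t]addrC.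
split; last exact: cvg_lim gv.
by apply/cvg_ex; exists v.
Unshelve. all: by end_near. Qed.

Lemma is_derive_ray_coord (R : realType) (n : nat) (g : R -> 'cV[R]_n) (t : R)
    (v : 'cV[R]_n) (k : 'I_n) :
  is_derive_ray g t v -> is_derive_ray (fun u => g u k 0 : R^o) t (v k 0).
Proof.
rewrite /is_derive_ray => gv.
have := @cvg_comp _ _ _ _ (fun M : 'cV[R]_n => M k 0) _ _ _ gv
  (@coord_continuous _ _ _ k 0 v).
by apply: cvg_trans; apply: near_eq_cvg; apply: nearW => h; rewrite /= !mxE.
Qed.

(** [g h] is [h] times the difference quotient plus [g 0]. This links the initial value to the
    monotonicity lemmas below, which compare times strictly inside a half-line only. *)
Lemma is_derive_ray0_right_continuous (R : realType) (g : R -> R) (v : R) :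
  is_derive_ray (g : R -> R^o) 0 v -> g h @[h --> 0^'+] --> g 0.
Proof.
rewrite /is_derive_ray => gv.
have {}gv : h^-1 * (g (0 + h) - g 0) @[h --> 0^'+] --> v.
  apply: cvg_trans gv; apply: cvg_app => B B0.
  apply: (@filterS _ (nbhs (0 : R)) _ _ _ _ B0) => h Bh h_gt0.
  by apply: Bh => /=; rewrite ?add0r ?(ltW h_gt0) ?lt0r_neq0.
have h0 : h @[h --> 0^'+] --> (0 : R) by exact: cvg_at_right_filter cvg_id.
have glim : h * (h^-1 * (g (0 + h) - g 0)) + g 0 @[h --> 0^'+] --> 0 * v + g 0.
  by apply: cvgD; [exact: cvgM h0 gv|exact: cvg_cst].
rewrite mul0r add0r in glim; apply: cvg_trans glim; apply: near_eq_cvg.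
near=> h.
rewrite /= add0r mulVKf ?subrK //; apply: lt0r_neq0; near: h; exact: nbhs_right_gt.
Unshelve. all: by end_near. Qed.

Lemma is_derive_le0_nincr (R : realType) (g g' : R -> R) (a : R) :
  (forall t : R, a < t -> is_derive t (1 : R) g (g' t)) ->
  (forall t, a < t -> g' t <= 0) ->
  forall u t, a < u -> u <= t -> g t <= g u.
Proof.
move=> dg g'_le0 u t au ut.
have [||c cut E] := @MVT_segment _ g g' u t ut.
- move=> z; rewrite in_itv /= => /andP[uz _]; apply: dg; exact: lt_trans uz.
- apply: derivable_within_continuous => z; rewrite in_itv /= => /andP[uz _].
  by have [] := dg z (lt_le_trans au uz).
move: cut; rewrite in_itv /= => /andP[uc _].
rewrite -subr_le0 E mulr_le0_ge0 ?subr_ge0 //.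
by apply: g'_le0; exact: lt_le_trans uc.
Qed.

Lemma is_derive_ge0_ndecr (R : realType) (g g' : R -> R) (a : R) :
  (forall t : R, a < t -> is_derive t (1 : R) g (g' t)) ->
  (forall t, a < t -> 0 <= g' t) ->
  forall u t, a < u -> u <= t -> g u <= g t.
Proof.
move=> dg g'_ge0 u t au ut; rewrite -lerN2.
apply: (is_derive_le0_nincr (g := fun z => - g z) (g' := fun z => - g' z)) au ut.
- by move=> z az; have := dg z az => ?; exact: is_deriveN.
- by move=> z az; rewrite oppr_le0 g'_ge0.
Qed.

(** * The scalar argument for the adaptive gain *)

Lemma adaptive_gain_cvg0 (R : realType) (U U' W c : R -> R) (a b K lam : R) :
  0 < a -> 0 < b -> 0 < lam -> 0 <= K ->
  (forall t : R, 0 < t -> is_derive t (1 : R) U (U' t)) ->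
  (forall t : R, 0 < t -> is_derive t (1 : R) c (a * W t)) ->
  (forall t, 0 < t -> 0 <= U t) -> (forall t, 0 < t -> b * U t <= W t) ->
  (forall t, 0 < t -> 0 <= c t) ->
  (forall t, 0 < t -> U' t <= (K - lam * c t) * W t) ->
  U t @[t --> +oo] --> (0 : R).
Proof.
move=> a0 b0 lam0 K0 dU dc U_ge0 W_ge c_ge0 U'_le.
have W_ge0 t : 0 < t -> 0 <= W t.
  by move=> t0; apply: le_trans (W_ge t t0); rewrite mulr_ge0 ?U_ge0 // ltW.
have c_ndecr u t : 0 < u -> u <= t -> c u <= c t.
  by apply: (is_derive_ge0_ndecr dc) => z z0; rewrite mulr_ge0 ?W_ge0 // ltW.
have G_nincr u t : 0 < u -> u <= t ->
    U t + a^-1 * (lam / 2 * c t ^+ 2 - K * c t)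
    <= U u + a^-1 * (lam / 2 * c u ^+ 2 - K * c u).
  apply: (is_derive_le0_nincr (a := 0)
    (g := fun z => U z + a^-1 * (lam / 2 * c z ^+ 2 - K * c z))
    (g' := fun z => U' z + (lam * c z - K) * W z)) => z z0.
    have := dU z z0; have := dc z z0 => ? ?; apply: is_derive_eq.
    rewrite /GRing.scale /=; field; exact: lt0r_neq0.
  by have := U'_le z z0; nra.
have H_nincr u t : 0 < u -> u <= t ->
    U t - K / a * c t <= U u - K / a * c u.
  apply: (is_derive_le0_nincr (a := 0) (g := fun z => U z - K / a * c z)
    (g' := fun z => U' z - K * W z)) => z z0.
    have := dU z z0; have := dc z z0 => ? ?; apply: is_derive_eq.
    rewrite /GRing.scale /=; field; exact: lt0r_neq0.
  have := U'_le z z0; have := mulr_ge0 (mulr_ge0 (ltW lam0) (c_ge0 z z0)) (W_ge0 z z0).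
  nra.
have [M cM] : exists M, forall t, 1 <= t -> c t <= M.
  pose G := a * (U 1 + a^-1 * (lam / 2 * c 1 ^+ 2 - K * c 1)).
  (* Beyond this value [lam / 2 * c t - K >= 1], so [c t <= c t * (lam / 2 * c t - K) <= G], a
     contradiction. *)
  exists (`|G| + 2 / lam * (K + 1)) => t t1.
  have t0 : 0 < t by rewrite (lt_le_trans _ t1).
  have quad : lam / 2 * c t ^+ 2 - K * c t <= G.
    rewrite -[leLHS](mulVKf (lt0r_neq0 a0)) /G ler_pM2l //.
    by apply: le_trans (G_nincr 1 t ltr01 t1); rewrite lerDr U_ge0.
  have [//|ct] := leP (c t) (`|G| + 2 / lam * (K + 1)).
  have G_le := ler_norm G; have G_ge0 := normr_ge0 G.
  have h1 : K + 1 <= lam / 2 * c t.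
    rewrite -ler_pdivrMl ?divr_gt0 // invf_div.
    by apply: le_trans (ltW ct); rewrite lerDr.
  have h2 : c t <= G by nra.
  have : 0 < 2 / lam * (K + 1) by rewrite mulr_gt0 ?divr_gt0 // ltr_wpDl.
  lra.
pose E := c @` [set t | 1 <= t].
have E_sup : has_sup E.
  split; first by exists (c 1), 1 => //=.
  by exists M => _ [t /= t1 <-]; exact: cM.
have c_sup t : 1 <= t -> c t <= sup E.
  by move=> t1; apply: ub_le_sup; [exact: E_sup.2|exists t].
apply/cvgrPdist_le => e e0.
(* Chosen so that [d + K / a * d = e]: one [d] for the value of [U] at [T], and [K / a * d] for its
   later increase. *)
pose d := e / (1 + K / a).
have Ka_ge0 : 0 <= K / a by rewrite divr_ge0 // ltW.
have d0 : 0 < d by rewrite divr_gt0 // ltr_wpDr.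
have [_ [T0 /= T01 <-] cT0] := sup_adherent d0 E_sup.
(* If [U] stayed above [d] after [T0], then [c' >= a * b * d] there, and [c] would outgrow its bound
   [M]. Both times in [lin] are shifted by [1] to lie strictly beyond [T0]. *)
have [T TT0 UT] : exists2 T, T0 <= T & U T <= d.
  apply: contrapT => nT.
  have U_gt t : T0 <= t -> d < U t.
    by move=> tT0; rewrite ltNge; apply/negP => Ut; apply: nT; exists t.
  have T00 : 0 < T0 by rewrite (lt_le_trans _ T01).
  have lin t : T0 < t -> c (T0 + 1) - a * b * d * (T0 + 1) <= c (t + 1) - a * b * d * (t + 1).
    move=> tT0; apply: (is_derive_ge0_ndecr (g := fun z => c z - a * b * d * z)
        (g' := fun z => a * W z - a * b * d) (a := T0)); last 2 first.
    - by rewrite ltrDl.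
    - by rewrite lerD2r ltW.
    - move=> z zT0; have := dc z (lt_trans T00 zT0) => ?; apply: is_derive_eq.
      by rewrite /GRing.scale /= mulr1.
    - move=> z zT0; rewrite subr_ge0 -mulrA ler_pM2l //.
      apply: le_trans (W_ge z (lt_trans T00 zT0)); rewrite ler_pM2l //.
      by rewrite ltW // U_gt // ltW.
  have abd0 : 0 < a * b * d by apply: mulr_gt0 d0; exact: mulr_gt0.
  (* Linear growth from [T0 + 1] to [t + 1] amounts to [|M| + 1], and [c] starts nonnegative. *)
  pose t := T0 + (`|M| + 1) / (a * b * d).
  have tT0 : T0 < t by rewrite ltrDl divr_gt0 // ltr_wpDl.
  have := lin t tT0.
  have := cM (t + 1) ltac:(lra); have := c_ge0 (T0 + 1) ltac:(lra).
  have -> : a * b * d * (t + 1) = a * b * d * (T0 + 1) + (`|M| + 1).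
    by rewrite /t; field; rewrite !lt0r_neq0.
  have := ler_norm M; lra.
near=> t.
have Tt : T <= t by near: t; apply: nbhs_pinfty_ge; rewrite num_real.
have T_gt0 : 0 < T by rewrite (lt_le_trans _ TT0) // (lt_le_trans _ T01).
have t0 : 0 < t by exact: lt_le_trans Tt.
rewrite sub0r normrN ger0_norm ?U_ge0 //.
have := H_nincr T t T_gt0 Tt; have := c_sup t (le_trans T01 (le_trans TT0 Tt)).
have : c T0 <= c T by apply: c_ndecr => //; rewrite (lt_le_trans _ T01).
move=> h1 h2 h3.
(* After [T] the gain can rise by less than [d], since [c T >= c T0 > sup E - d] and
   [c t <= sup E]. *)
have h4 : K / a * (c t - c T) <= K / a * d by rewrite ler_wpM2l //; lra.
have -> : e = d + K / a * d.
  by rewrite /d; field; rewrite !lt0r_neq0 // ltr_wpDr // ltW.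
lra.
Unshelve. all: by end_near. Qed.

(** * The Lyapunov estimate along the network *)

Lemma mulmx_diag_formE (R : realType) (n : nat) (p : 'rV[R]_n)
    (u v : 'cV[R]_n) :
  (u^T *m diag_mx p *m v) 0 0 = \sum_k p 0 k * (u k 0 * v k 0).
Proof.
rewrite mul_mx_diag mxE; apply: eq_bigr => k _; rewrite !mxE.
by rewrite mulrAC mulrC.
Qed.

Lemma is_derive_sum_fun (R : realType) (n : nat) (h : 'I_n -> R -> R)
    (d : 'I_n -> R) (t : R) :
  (forall i, is_derive t (1 : R) (h i) (d i)) ->
  is_derive t (1 : R) (fun u => \sum_i h i u) (\sum_i d i).
Proof.
move=> dh; have -> : (fun u => \sum_i h i u) = \sum_i h i.
  by apply/funext => u; rewrite fct_sumE.
exact: is_derive_sum.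
Qed.

(** The sum splits in two. In the [F] part, the dissipativity hypothesis leaves only the [Delta]
    terms, and each [Delta k] and [xi i] is bounded by its total. In the coupling part, exchanging
    the sums lets the coercivity act on each coordinate [k] separately, with weight [p k]. *)
Lemma lyapunov_rate_le (R : realType) (n m : nat) (A : 'M[R]_m.+1)
    (eps lam c : R) (xi : 'I_m.+1 -> R) (p Delta : 'I_n -> R)
    (e F : 'I_m.+1 -> 'I_n -> R) :
  (forall i, 0 < xi i) -> (forall k, 0 < p k) -> (forall k, 0 < Delta k) ->
  0 <= c ->
  (forall y : 'I_m.+1 -> R,
    \sum_i xi i * y i * (\sum_j A i j * y j - (i == ord0)%:R * eps * y i)
    <= - lam * \sum_i y i ^+ 2) ->
  (forall i, \sum_k p k * (e i k * (F i k - Delta k * e i k)) <= 0) ->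
  \sum_i xi i * \sum_k p k * (e i k *
     (F i k + c * (\sum_j A i j * e j k) - (i == ord0)%:R * (c * eps) * e i k))
  <= ((\sum_i xi i) * (\sum_k Delta k) - lam * c) *
     \sum_i \sum_k p k * e i k ^+ 2.
Proof.
move=> xi_gt0 p_gt0 Delta_gt0 c_ge0 coer Fe.
have xi_le i : xi i <= \sum_i xi i.
  by rewrite (bigD1 i) //= lerDl sumr_ge0 // => j _; exact: ltW.
have Delta_le k : Delta k <= \sum_k Delta k.
  by rewrite (bigD1 k) //= lerDl sumr_ge0 // => j _; exact: ltW.
have pe_ge0 i k : 0 <= p k * e i k ^+ 2 by rewrite mulr_ge0 ?sqr_ge0 // ltW.
have pointwise i : \sum_k p k * (e i k * F i k) <=
    (\sum_k Delta k) * \sum_k p k * e i k ^+ 2.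
  rewrite -[leLHS](subrK (\sum_k Delta k * (p k * e i k ^+ 2))) -sumrB.
  apply: (@le_trans _ _ (0 + \sum_k Delta k * (p k * e i k ^+ 2))).
    rewrite lerD2r; apply: le_trans (Fe i); apply: ler_sum => k _.
    by rewrite le_eqVlt; apply/orP; left; apply/eqP; ring.
  by rewrite add0r mulr_sumr; apply: ler_sum => k _; rewrite ler_wpM2r.
have -> : \sum_i xi i * \sum_k p k * (e i k *
     (F i k + c * (\sum_j A i j * e j k) - (i == ord0)%:R * (c * eps) * e i k))
  = \sum_i xi i * (\sum_k p k * (e i k * F i k))
    + c * \sum_k p k * \sum_i xi i * e i k *
        (\sum_j A i j * e j k - (i == ord0)%:R * eps * e i k).
  rewrite mulr_sumr; under [X in _ = _ + X]eq_bigr do rewrite !mulr_sumr.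
  rewrite exchange_big -big_split /=; apply: eq_bigr => i _.
  rewrite !mulr_sumr -big_split /=; apply: eq_bigr => k _; ring.
rewrite mulrBl; apply: lerD.
  rewrite [leRHS]mulr_sumr; apply: ler_sum => i _.
  apply: le_trans (ler_wpM2l (ltW (xi_gt0 i)) (pointwise i)) _.
  rewrite -mulrA ler_wpM2r // mulr_ge0 ?sumr_ge0 // => k _.
  exact: ltW.
rewrite exchange_big /=; set Sw := (X in - (_ * X)).
have -> : - (lam * c * Sw) = c * (- lam * Sw) by ring.
rewrite ler_wpM2l // /Sw mulr_sumr; apply: ler_sum => k _.
by rewrite -mulr_sumr mulrCA ler_wpM2l //; exact: ltW.
Qed.

(** * Synchronization of the adaptive network *)

Theorem theorem5 (R : realType) (n m : nat)
  (f : 'cV[R]_n -> R -> 'cV[R]_n)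
  (f_cont : {within [set z : 'cV[R]_n * R | 0 <= z.2],
               continuous (fun z : 'cV[R]_n * R => f z.1 z.2)})
  (s : R -> 'cV[R]_n)
  (s_sol : forall t : R, 0 <= t -> is_derive_ray s t (f (s t) t))
  (A : 'M[R]_m.+1)
  (A_irr : irreducible_mx A)
  (A_rank : \rank A = (m.+1 - 1)%N)
  (A_offdiag : forall i j : 'I_m.+1, i != j -> 0 <= A i j)
  (A_rowsum : forall i : 'I_m.+1, \sum_(j < m.+1) A i j = 0)
  (eps : R) (eps_gt0 : 0 < eps)
  (p Delta : 'rV[R]_n)
  (p_gt0 : forall k : 'I_n, 0 < p 0 k)
  (Delta_gt0 : forall k : 'I_n, 0 < Delta 0 k)
  (eta : R) (eta_gt0 : 0 < eta)
  (f_quad : forall (x y : 'cV[R]_n) (t : R), 0 <= t ->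
     ((x - y)^T *m diag_mx p *m
        (f x t - diag_mx Delta *m x - f y t + diag_mx Delta *m y)) 0 0
     <= - eta * ((x - y)^T *m (x - y)) 0 0)
  (alpha : R) (alpha_gt0 : 0 < alpha)
  (x : 'I_m.+1 -> R -> 'cV[R]_n) (c : R -> R)
  (c0_ge0 : 0 <= c 0)
  (x_first : forall t : R, 0 <= t ->
     is_derive_ray (x ord0) t
       (f (x ord0 t) t + c t *: (\sum_(j < m.+1) A ord0 j *: x j t)
        - (c t * eps) *: (x ord0 t - s t)))
  (x_other : forall i : 'I_m.+1, i != ord0 -> forall t : R, 0 <= t ->
     is_derive_ray (x i) t
       (f (x i t) t + c t *: (\sum_(j < m.+1) A i j *: x j t)))
  (c_adapt : forall t : R, 0 <= t ->
     is_derive_ray (c : R -> R^o) t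
       (alpha / 2 * \sum_(i < m.+1)
          ((x i t - s t)^T *m diag_mx p *m (x i t - s t)) 0 0)) :
  forall i : 'I_m.+1, enorm (x i t - s t) @[t --> +oo] --> (0 : R).
Proof.
clear f_cont A_rank.
have [xi xi_gt0 xiA] := irreducible_mx_left_kernel_gt0 A_irr A_offdiag A_rowsum.
have [lam lam_gt0 coer] :=
  pinned_laplacian_coercive A_irr A_offdiag A_rowsum eps_gt0 xi_gt0 xiA.
pose e i k t := x i t k 0 - s t k 0.
pose F i k t : R := (f (x i t) t - f (s t) t) k 0.
pose W t := \sum_i \sum_k p 0 k * e i k t ^+ 2.
pose U t := 2^-1 * \sum_i xi i * \sum_k p 0 k * e i k t ^+ 2.
pose de i k t := F i k t + c t * (\sum_j A i j * e j k t)
                 - (i == ord0)%:R * (c t * eps) * e i k t.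
have w_ge0 i (t : R) : 0 <= \sum_k p 0 k * e i k t ^+ 2.
  by apply: sumr_ge0 => k _; rewrite mulr_ge0 ?sqr_ge0 // ltW.
have U_ge0 (t : R) : 0 <= U t.
  by rewrite mulr_ge0 // sumr_ge0 // => i _; apply: mulr_ge0 (w_ge0 _ _); exact: ltW.
have W_ge0 (t : R) : 0 <= W t by exact: sumr_ge0.
have Asum_shift i (t : R) k : \sum_j A i j * x j t k 0 = \sum_j A i j * e j k t.
  under [RHS]eq_bigr do rewrite /e mulrBr.
  by rewrite sumrB -mulr_suml A_rowsum mul0r subr0.
(* The factor [(i == ord0)%:R] merges the pinned equation and the others into one formula. *)
have dx i (t : R) : 0 <= t -> is_derive_ray (x i) t
    (f (x i t) t + c t *: (\sum_j A i j *: x j t)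
     - ((i == ord0)%:R * (c t * eps)) *: (x i t - s t)).
  move=> t_ge0; have [->|i0] := eqVneq i ord0; first by rewrite mul1r; exact: x_first.
  by rewrite mul0r scale0r subr0; exact: x_other.
have dE i k (t : R) : 0 < t -> is_derive t (1 : R) (e i k) (de i k t).
  move=> t_gt0.
  have h1 := is_derive_ray_gt0 t_gt0 (is_derive_ray_coord (k := k) (dx i t (ltW t_gt0))).
  have h2 := is_derive_ray_gt0 t_gt0 (is_derive_ray_coord (k := k) (s_sol t (ltW t_gt0))).
  apply: is_derive_eq; rewrite /de /F -Asum_shift !mxE summxE.
  under eq_bigr do rewrite mxE.
  by rewrite /e; ring.
have dU (t : R) : 0 < t -> is_derive t (1 : R) U
    (\sum_i xi i * \sum_k p 0 k * (e i k t * de i k t)).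
  move=> t_gt0.
  (* Nested scalings are the shape on which the derivative rules for scaling and sums act; [2] and
     [^+ 1] mirror the power rule. *)
  have -> : \sum_i xi i * \sum_k p 0 k * (e i k t * de i k t) =
      2^-1 *: \sum_i xi i *: \sum_k p 0 k *: ((2%:R * e i k t ^+ 1) *: de i k t).
    rewrite /GRing.scale /= mulr_sumr; apply: eq_bigr => i _.
    rewrite mulrCA; congr (_ * _); rewrite mulr_sumr; apply: eq_bigr => k _.
    by field.
  apply: is_deriveZ; apply: is_derive_sum_fun => i.
  apply: is_deriveZ; apply: is_derive_sum_fun => k.
  apply: is_deriveZ; have ? := dE i k t t_gt0; apply: is_derive_eq.
  by rewrite /GRing.scale /=; ring.
have dc (t : R) : 0 <= t -> is_derive_ray (c : R -> R^o) t (alpha / 2 * W t).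
  move=> t_ge0.
  have -> : W t =
      \sum_i ((x i t - s t)^T *m diag_mx p *m (x i t - s t)) 0 0.
    apply: eq_bigr => i _; rewrite mulmx_diag_formE; apply: eq_bigr => k _.
    by rewrite !mxE.
  exact: c_adapt.
have alpha2_gt0 : 0 < alpha / 2 by rewrite divr_gt0.
have dc_gt0 (t : R) : 0 < t -> is_derive t (1 : R) c (alpha / 2 * W t).
  by move=> t_gt0; apply: is_derive_ray_gt0 => //; apply: dc; exact: ltW.
have c_ge0 (t : R) : 0 < t -> 0 <= c t.
  move=> t_gt0; apply: le_trans c0_ge0 _.
  (* [c h <= c t] for [0 < h <= t]; let [h] tend to [0] from the right. *)
  apply: (cvgr_to_le (is_derive_ray0_right_continuous (dc 0 (lexx _)))).
  near=> h; apply: (is_derive_ge0_ndecr (a := 0) dc_gt0).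
  - by move=> z _; rewrite mulr_ge0 // ltW.
  - by near: h; exact: nbhs_right_gt.
  - by near: h; exact: nbhs_right_le.
have Fe i (t : R) : 0 <= t ->
    \sum_k p 0 k * (e i k t * (F i k t - Delta 0 k * e i k t)) <= 0.
  move=> t_ge0; apply: (@le_trans _ _ (- eta * ((x i t - s t)^T *m (x i t - s t)) 0 0)).
    apply: le_trans (f_quad (x i t) (s t) t t_ge0).
    rewrite mulmx_diag_formE le_eqVlt; apply/orP; left; apply/eqP.
    apply: eq_bigr => k _; rewrite !mul_diag_mx !mxE /F /e !mxE; ring.
  rewrite mulNr oppr_le0 mulr_ge0 ?(ltW eta_gt0) // mxE sumr_ge0 // => k _.
  by rewrite !mxE -expr2 sqr_ge0.
have Xi_gt0 : 0 < \sum_i xi i.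
  by rewrite (bigD1 ord0) //= ltr_wpDr // sumr_ge0 // => i _; exact: ltW.
have U_cvg : U t @[t --> +oo] --> (0 : R).
  (* [b] reflects [U <= (\sum_i xi i) * W], and [K] is the constant of [lyapunov_rate_le]. *)
  apply: (adaptive_gain_cvg0 (W := W) (c := c) (lam := lam)
    (b := (\sum_i xi i)^-1) (K := (\sum_i xi i) * \sum_k Delta 0 k)
    alpha2_gt0 _ lam_gt0 _ dU dc_gt0) => //.
  - by rewrite invr_gt0.
  - by rewrite mulr_ge0 ?(ltW Xi_gt0) // sumr_ge0 // => k _; exact: ltW.
  - move=> t _; rewrite mulrC ler_pdivrMr // mulrC /U.
    apply: (@le_trans _ _ (\sum_i xi i * \sum_k p 0 k * e i k t ^+ 2)).
      rewrite ler_piMl ?invf_le1 ?ler1n //.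
      by apply: sumr_ge0 => i _; apply: mulr_ge0 (w_ge0 _ _); exact: ltW.
    rewrite /W mulr_sumr; apply: ler_sum => i _; rewrite ler_wpM2r //.
    by rewrite [leRHS](bigD1 i) //= lerDl sumr_ge0 // => j _; exact: ltW.
  - move=> t t_gt0; apply: lyapunov_rate_le => //; first exact: c_ge0.
    by move=> i; apply: Fe; exact: ltW.
move=> i.
(* [U] contains the term [xi i * p 0 k * e i k t ^+ 2 / 2], and its other terms are nonnegative. *)
pose C := \sum_k 2 / (xi i * p 0 k).
have e_le t : \sum_k e i k t ^+ 2 <= C * U t.
  rewrite mulr_suml; apply: ler_sum => k _.
  have xp_gt0 : 0 < xi i * p 0 k by rewrite mulr_gt0.
  rewrite mulrAC ler_pdivlMr // /U mulVKf // (bigD1 i) //= (bigD1 k) //=.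
  rewrite [leLHS](_ : _ = xi i * (p 0 k * e i k t ^+ 2)); last by ring.
  rewrite mulrDr -addrA lerDl addr_ge0 //.
    apply: mulr_ge0; first exact: ltW.
    by apply: sumr_ge0 => l _; rewrite mulr_ge0 ?sqr_ge0 // ltW.
  by apply: sumr_ge0 => l _; apply: mulr_ge0 (w_ge0 _ _); exact: ltW.
have sqrt_cvg : Num.sqrt (C * U t) @[t --> +oo] --> (0 : R).
  rewrite -[X in _ --> X]sqrtr0 -(mulr0 C).
  have CU : C * U t @[t --> +oo] --> C * 0 by exact: cvgM (cvg_cst C) U_cvg.
  by apply: continuous_cvg CU; exact: sqrt_continuous.
apply: (squeeze_cvgr _ (cvg_cst 0) sqrt_cvg); apply: nearW => t.
rewrite /enorm sqrtr_ge0 /=; apply: ler_wsqrtr; apply: le_trans (e_le t).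
rewrite mxE le_eqVlt; apply/orP; left; apply/eqP; apply: eq_bigr => k _.
by rewrite !mxE -expr2.
Unshelve. all: by end_near. Qed.
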